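(* Let $n\ge 2$. For every subset $J\subseteq[n-2]$, $$|\{c\in Ct_n:\ \mathrm{Des}(c)=J\}|=|J|+1.$$
   Context: Notation: $[m]=\{1,\dots,m\}$ (empty for $m=0$); vertex labels are taken modulo $n$ in $[n]$; products of permutations are composed from right to left. $F_n$ is the set of sequences $w=(t_1,\dots,t_{n-1})$ of transpositions in $\mathfrak{S}_n$ with $t_1\cdots t_{n-1}=(1,2,\dots,n)$ (the cycle $1\mapsto2\mapsto\cdots\mapsto n\mapsto1$). For such $w$, $G(w)$ is the geometric graph whose vertices are those of a regular $n$-gon labeled clockwise $1,\dots,n$, with one straight-line edge joining $i$ and $j$ for each transposition $t_k=(i,j)$. A caterpillar is a tree such that removing all its leaves leaves a (possibly empty or one-vertex) path, called its spine. A convex caterpillar of order $n$ is a caterpillar whose vertices are those of a regular $n$-gon labeled $1,\dots,n$ clockwise, whose edges are non-crossing straight line segments, and whose spine forms a cyclic interval of edges $(a,a+1),(a+1,a+2),\dots,(b-1,b)$ (labels mod $n$; possibly no edges). $Ct_n$ is the set of convex caterpillars of order $n$. It is known that for each $c\in Ct_n$ there is a unique $(t_1,\dots,t_{n-1})\in F_n$ with $G(t_1,\dots,t_{n-1})=c$, and that consecutive $t_i,t_{i+1}$ then share a common letter; $c$ is identified with this sequence. The descent set is $$\mathrm{Des}(c)=\{i\in[n-2]: t_i=(b,c')\text{ and }t_{i+1}=(b,a)\text{ with }c'>a\},$$ where $b$ is the common letter of $t_i$ and $t_{i+1}$ and $c'>a$ is in the usual order on integers. *)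

(* Defs.v *)
From HB Require Import structures.
From mathcomp Require Import all_boot all_order all_algebra fingroup perm.
From mathcomp Require Import boolp classical_sets set_interval reals trigo.

Set Implicit Arguments.
Unset Strict Implicit.
Unset Printing Implicit Defensive.

Import Order.TTheory GRing.Theory Num.Theory.

Local Open Scope ring_scope.

(* The paper's labels 1, ..., n are the elements 0, ..., n - 1 of 'I_n, in the
   same order, and [ordS] is the cyclic successor.  Likewise the positions
   1, ..., n - 2 of descents are the elements of 'I_(n.-2). *)

Section Graph.
Variable T : finType.
Implicit Types (E : {set {set T}}) (V : {set T}) (s : seq T).

(* A graph with vertex set T is given by its set of edges, an edge being the
   set of its two ends. *)
Definition simple_graph E : Prop := forall e, e \in E -> #|e| = 2%N.

Definition adj E : rel T := fun x y => [set x; y]%SET \in E.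

Definition connected_graph E : Prop := forall x y : T, connect (adj E) x y.

Definition acyclic_graph E : Prop :=
  forall s, (2 < size s)%N -> uniq s -> ~~ path.cycle (adj E) s.

Definition is_tree E : Prop :=
  [/\ simple_graph E, connected_graph E & acyclic_graph E].

Definition degree E (x : T) : nat := #|[set e in E | x \in e]%SET|.

Definition path_edges s : {set {set T}} :=
  [set:: [seq [set p.1; p.2]%SET | p <- zip s (behead s)]]%SET.

Definition is_path_graph V E : Prop :=
  exists s, [/\ uniq s, V = [set:: s]%SET & E = path_edges s].

Definition spine_vertices E : {set T} := [set x | degree E x != 1%N]%SET.

Definition spine_edges E : {set {set T}} :=
  [set e in E | e \subset spine_vertices E]%SET.

Definition is_caterpillar E : Prop :=
  is_tree E /\ is_path_graph (spine_vertices E) (spine_edges E).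

End Graph.

Section Geometry.
Variable R : realType.

Definition ngon_vertex (n : nat) (i : 'I_n) : R^o * R^o :=
  let theta := - (2 * pi * i%:R / n%:R) in (cos theta, sin theta).

Definition open_segment (p q : R^o * R^o) : set (R^o * R^o) :=
  [set (1 - s) *: p + s *: q | s in `]0, 1[%classic]%classic.

Definition noncrossing (n : nat) (E : {set {set 'I_n}}) : Prop :=
  forall a b c d : 'I_n,
    [set a; b]%SET \in E -> [set c; d]%SET \in E ->
    [set a; b]%SET != [set c; d]%SET ->
    (open_segment (ngon_vertex a) (ngon_vertex b)
       `&` open_segment (ngon_vertex c) (ngon_vertex d) = set0)%classic.

(* [path_edges (traject (@ordS n) a m.+1)] is the set of the m edges
   (a, a+1), (a+1, a+2), ..., (a+m-1, a+m), labels modulo n. *)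
Definition convex_caterpillar (n : nat) (E : {set {set 'I_n}}) : Prop :=
  [/\ is_caterpillar E, noncrossing E &
      exists a : 'I_n, exists2 m : nat, (m < n)%N &
        spine_edges E = path_edges (traject (@ordS n) a m.+1)].

Definition convex_caterpillars (n : nat) : {set {set {set 'I_n}}} :=
  [set E : {set {set 'I_n}} | `[< convex_caterpillar E >]]%SET.

End Geometry.

Section Factorizations.
Variable n : nat.
Implicit Types (w : n.-1.-tuple {perm 'I_n}) (c : {set {set 'I_n}}).

Definition is_transposition (t : {perm 'I_n}) : bool :=
  [exists i, exists j, (i != j) && (t == tperm i j)].

Definition long_cycle : {perm 'I_n} := perm (@ordS_inj n).

(* In MathComp (s * t) x = t (s x), whence the reversal. *)
Definition cycle_factorizations : {set n.-1.-tuple {perm 'I_n}} :=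
  [set w : n.-1.-tuple {perm 'I_n} |
     all is_transposition w && (\prod_(t <- rev w) t == long_cycle)%g]%SET.

Definition graph_of w : {set {set 'I_n}} :=
  [set e | [exists i, exists j,
     [&& i != j, tperm i j \in val w & e == [set i; j]%SET]]]%SET.

Definition Des_word w : {set 'I_n.-2} :=
  [set i : 'I_n.-2 | [exists b, exists c' : 'I_n, exists a : 'I_n,
     [&& nth 1%g w i == tperm b c', nth 1%g w i.+1 == tperm b a
       & (a < c')%N]]]%SET.

(* The factorization identified with c: for c in [convex_caterpillars R n] it
   exists and is unique, so neither the choice nor the default value matters. *)
Definition word_of c : n.-1.-tuple {perm 'I_n} :=
  odflt [tuple of nseq n.-1 1%g]
    [pick w in cycle_factorizations | graph_of w == c].

Definition Des c : {set 'I_n.-2} := Des_word (word_of c).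

End Factorizations.

(* Main.v *)
Require Import Defs.
From mathcomp Require Import all_boot all_order all_algebra fingroup perm.
From mathcomp Require Import boolp classical_sets set_interval reals trigo.
From mathcomp Require Import zify ring lra.

(** Run along a convex caterpillar from one end of its spine to the other: each
edge joins the current spine vertex, the pivot, to a new vertex.  The vertices
met so far form an arc of the polygon, and the next edge enlarges this arc at
one of its two ends: either it reaches a new leaf at the counterclockwise end,
or it advances along the spine, at the clockwise end, and the new vertex
becomes the pivot.  So a convex caterpillar with n > 2 vertices is coded by a
starting vertex a and a binary word b, where [b i] tells whether the i-th edge
advances.  The first letter may be taken to be [false], since the first spine
vertex carries a leaf, and both values of the last letter give the same edge,
since the last vertex is next to both ends of the arc.

That codes give convex caterpillars is [code_graph_convex], and the converse is
[convex_caterpillar_code]; crossings of chords are read off from the sign of the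
area of a triangle with vertices on a circle ([cross_offset]).  The edges of a
code, in order, form the factorization of the long cycle ([word_of_code]): its
uniqueness holds because every edge has a new endpoint and shares its other
endpoint with the edge before ([grown_factorization_uniq]).

Descents compare the two neighbours of the pivot on consecutive edges.  Seen
from the pivot these neighbours always turn counterclockwise, so labels decrease
except when passing from the smallest to the largest.  As long as the arc of
visited vertices does not pass from the last label to the first one, the descents
spell the word b shifted by one and complemented; when the arc has just crossed
this junction a descent is forced; and from then on the descents spell the
complement of b ([descent_straight], [descent_wrapped]).  Hence a caterpillar is
determined by its descent set J and by the moment of the crossing, which is
either an element of J or comes with the last edge ([code_from_descents]).
Conversely each of these |J| + 1 moments occurs ([start_descent]).  For n = 2
there is only one graph. *)

Set Implicit Arguments.
Unset Strict Implicit.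
Unset Printing Implicit Defensive.

Import Order.TTheory GRing.Theory Num.Theory.

(** * Factorizations along a growing tree *)

Section Growing.
Variable T : finType.
Implicit Types (es : seq (T * T)) (u v : seq {perm T}).
Local Open Scope group_scope.

Definition edge_tperm (e : T * T) : {perm T} := tperm e.1 e.2.

(** Edges are listed latest first, as (old endpoint, new endpoint): the graph
grows from the end of the list by pendant edges.  This order is also the one in
which the transpositions of a factorization are applied. *)
Fixpoint grown es : bool :=
  if es is e :: r then
    [&& e.1 != e.2, all (fun f : T * T => (e.2 != f.1) && (e.2 != f.2)) r & grown r]
  else true.

Fixpoint linked es : bool :=
  if es is e :: ((f :: _) as r) then
    ((e.1 == f.1) || (e.1 == f.2)) && linked r
  else true.

Lemma prod_fix u x : {in u, forall t : {perm T}, t x = x} ->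
  (\prod_(t <- u) t) x = x.
Proof.
elim: u => [|t u IHu] fix_u; first by rewrite big_nil perm1.
rewrite big_cons permM fix_u ?mem_head // IHu // => s su.
by rewrite fix_u // in_cons su orbT.
Qed.

Lemma fresh_fix (e : T * T) (r : seq (T * T)) :
    all (fun f : T * T => (e.2 != f.1) && (e.2 != f.2)) r ->
  {in map edge_tperm r, forall t : {perm T}, t e.2 = e.2}.
Proof.
move=> /allP fresh _ /mapP[f fr ->]; have /andP[ne1 ne2] := fresh f fr.
by rewrite /edge_tperm tpermD // eq_sym.
Qed.

Lemma grown_uniq es : grown es -> uniq (map edge_tperm es).
Proof.
elim: es => //= e r IHr /and3P[ne fresh /IHr->]; rewrite andbT.
apply/negP => /(fresh_fix fresh); rewrite /edge_tperm tpermR.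
exact/eqP.
Qed.

(** In a forest the successive positions of p follow a trail that uses each
edge at most once, so p can return to its place only by never moving.  The proof
removes the latest edge, whose new endpoint is moved by no other transposition. *)
Lemma forest_fix es u p : grown es -> uniq u ->
    {subset u <= map edge_tperm es} ->
    (\prod_(t <- u) t) p = p ->
  {in u, forall t : {perm T}, t p = p}.
Proof.
elim: es u => [|e r IHr] u /=.
  by move=> _ _ sub _ t /sub.
case/and3P=> ne fresh gr uu sub fixp.
have fixr := fresh_fix fresh.
have [tu|tNu] := boolP (edge_tperm e \in u); last first.
  apply: (IHr u) => // t tu; have := sub t tu; rewrite in_cons.
  by case/predU1P=> [tE|//]; rewrite -tE tu in tNu.
case/splitPr: tu uu sub fixp => v v'.
rewrite uniq_catC cat_cons cons_uniq mem_cat orbC -mem_cat uniq_catC.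
case/andP=> tN uvv sub; rewrite big_cat big_cons !permM /= => fixp.
have subv : {subset v ++ v' <= map edge_tperm r}.
  move=> t tv; have: t \in v ++ edge_tperm e :: v'.
    by move: tv; rewrite !mem_cat in_cons; case/orP=> ->; rewrite ?orbT.
  move/sub; rewrite in_cons; case/predU1P=> // tE.
  by rewrite -tE tv in tN.
have fv : (\prod_(t <- v) t) e.2 = e.2.
  by apply: prod_fix => t tv; apply: fixr; apply: subv; rewrite mem_cat tv.
have fv' : (\prod_(t <- v') t) e.2 = e.2.
  by apply: prod_fix => t tv; apply: fixr; apply: subv; rewrite mem_cat tv orbT.
have px : p != e.2.
  apply/eqP=> pE; move: fixp; rewrite pE fv /edge_tperm tpermR -[RHS]fv'.
  by move/perm_inj/eqP; rewrite (negPf ne).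
have yx : (\prod_(t <- v) t) p != e.2.
  by apply: contra px => /eqP yE; rewrite -(inj_eq (@perm_inj _ (\prod_(t <- v) t))) yE fv.
have yp : (\prod_(t <- v) t) p != e.1.
  apply/eqP=> yE; move: fixp; rewrite yE /edge_tperm tpermL fv' => pE.
  by rewrite pE eqxx in px.
have ty : edge_tperm e ((\prod_(t <- v) t) p) = (\prod_(t <- v) t) p.
  by rewrite /edge_tperm tpermD // eq_sym.
rewrite ty in fixp.
have IH : {in v ++ v', forall t : {perm T}, t p = p}.
  by apply: (IHr (v ++ v')) => //; rewrite big_cat permM.
have vp : (\prod_(t <- v) t) p = p.
  by apply: prod_fix => t tv; apply: IH; rewrite mem_cat tv.
rewrite vp in ty.
move=> t; rewrite mem_cat in_cons => /or3P[tv|/eqP->//|tv]; apply: IH;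
by rewrite mem_cat tv ?orbT.
Qed.

(** The product sends the old endpoint of the latest edge e to the new one, which
only e moves; hence the transpositions applied before e fix that old endpoint,
and by [forest_fix] none of them touches it.  They therefore commute with e,
and by induction they are the first ones of the remaining list; but the very
first of those touches the old endpoint of e, so e comes first. *)
Lemma grown_factorization_uniq es u : grown es -> linked es ->
    perm_eq u (map edge_tperm es) ->
    \prod_(t <- u) t = \prod_(t <- map edge_tperm es) t ->
  u = map edge_tperm es.
Proof.
elim: es u => [|e r IHr] u; first by move=> _ _ /perm_nilP.
move=> ger; have uer := grown_uniq ger; move: (ger) => /= /and3P[ne fresh gr].
move=> ler pu; have uu : uniq u by rewrite (perm_uniq pu).
have fixr := fresh_fix fresh.
have: edge_tperm e \in u by rewrite (perm_mem pu) mem_head.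
move=> tu; case/splitPr: tu pu uu => v v'.
rewrite perm_catC cat_cons perm_cons perm_catC => pu uu.
rewrite big_cat !big_cons /= => eqp.
have subv : {subset v <= map edge_tperm r}.
  by move=> t tv; rewrite -(perm_mem pu) mem_cat tv.
have subv' : {subset v' <= map edge_tperm r}.
  by move=> t tv; rewrite -(perm_mem pu) mem_cat tv orbT.
have fv' : (\prod_(t <- v') t) e.2 = e.2.
  by apply: prod_fix => t tv; exact/fixr/subv'.
have fv : (\prod_(t <- v) t) e.2 = e.2.
  by apply: prod_fix => t tv; exact/fixr/subv.
have vp : (\prod_(t <- v) t) e.1 = e.1.
  have := congr1 (fun s : {perm T} => s e.1) eqp.
  rewrite /= !permM {2}/edge_tperm tpermL (prod_fix fixr) -[RHS]fv'.
  move/perm_inj; rewrite -[RHS](tpermL e.1 e.2).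
  exact: perm_inj.
have fixv : {in v, forall t : {perm T}, t e.1 = e.1}.
  apply: (forest_fix gr) => //.
  by move: uu; rewrite cat_uniq => /and3P[].
have comm : \prod_(t <- v) t * edge_tperm e = edge_tperm e * \prod_(t <- v) t.
  by rewrite [RHS]conjgC /edge_tperm tpermJ fv vp.
have {}IHr : v ++ v' = map edge_tperm r.
  apply: IHr => //.
    by move: ler; case: (r) => //= f r' /andP[].
  by rewrite big_cat; apply: (mulgI (edge_tperm e)); rewrite -eqp !mulgA comm.
case: v IHr fixv {eqp pu uu subv fv vp comm} => [/= -> //|t v].
case: r ler gr fresh {fixr uer ger subv'} => //= f r /andP[/orP adj _] gr /andP[fresh _].
case=> -> _ /(_ _ (mem_head _ _)); rewrite /edge_tperm.
case: adj => /eqP eE; rewrite eE ?tpermL ?tpermR => ff;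
by move: gr => /= /andP[]; rewrite ff eqxx.
Qed.

End Growing.

(** * Caterpillars encoded by binary words *)

Fixpoint ntrue (b : nat -> bool) (i : nat) : nat :=
  if i is k.+1 then ntrue b k + b k else 0.

Definition nfalse (b : nat -> bool) : nat -> nat := ntrue (fun k => ~~ b k).

Lemma ntrueS b i : ntrue b i.+1 = ntrue b i + b i. Proof. by []. Qed.

Lemma nfalseS b i : nfalse b i.+1 = nfalse b i + ~~ b i. Proof. by []. Qed.

Lemma ntrueDnfalse b i : ntrue b i + nfalse b i = i.
Proof.
by elim: i => // i IHi; rewrite ntrueS nfalseS; case: (b i) => /=; lia.
Qed.

Lemma ntrue_mono b i j : i <= j -> ntrue b i <= ntrue b j.
Proof.
elim: j => [|j IHj]; first by rewrite leqn0 => /eqP->.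
rewrite leq_eqVlt => /predU1P[->//|/IHj]; rewrite ntrueS; lia.
Qed.

Lemma nfalse_mono b i j : i <= j -> nfalse b i <= nfalse b j.
Proof. exact: ntrue_mono. Qed.

(** The counting function starts at 0 and has unit steps, so it takes every
intermediate value, last at a position where the word is true. *)
Lemma ntrue_onto b o k : o < ntrue b k -> exists i, [/\ i < k, ntrue b i = o & b i].
Proof.
elim: k => //= k IHk lt_o; have [/IHk[i [ik <- bi]]|] := ltnP o (ntrue b k).
  by exists i; split=> //; lia.
by move=> ge_o; exists k; split; move: lt_o; case: (b k); lia.
Qed.

Lemma nfalse_onto b o k : o < nfalse b k ->
  exists i, [/\ i < k, nfalse b i = o & ~~ b i].
Proof. exact: ntrue_onto. Qed.

Lemma eq_ntrue b b' k : (forall i, i < k -> b i = b' i) -> ntrue b k = ntrue b' k.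
Proof. by elim: k => //= k IHk eqb; rewrite eqb // IHk // => i ik; apply: eqb; lia. Qed.

Lemma eq_nfalse b b' k : (forall i, i < k -> b i = b' i) -> nfalse b k = nfalse b' k.
Proof. by move=> eqb; apply: eq_ntrue => i ik; rewrite eqb. Qed.

Section Offsets.
Variable n : nat.
Implicit Types (a x : 'I_n) (b : nat -> bool).

Definition offset a (o : nat) : 'I_n := iter o (@ordS n) a.

Lemma offset_val a o : offset a o = (a + o) %% n :> nat.
Proof.
elim: o => [|o IHo]; first by rewrite addn0 modn_small.
by rewrite /offset iterS /= -/(offset a o) IHo -addn1 modnDml addn1 addnS.
Qed.

Lemma offsetS a o : offset a o.+1 = ordS (offset a o). Proof. by []. Qed.

Lemma offset_valE a o : o <= n ->
  offset a o = (if a + o < n then a + o else a + o - n) :> nat.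
Proof.
move=> on; rewrite offset_val; case: ltnP => h; first by rewrite modn_small.
have an := ltn_ord a.
by rewrite -[in LHS](subnK h) modnDr modn_small //; lia.
Qed.

Lemma offsetn a : offset a n = a.
Proof. by apply: val_inj; rewrite /= offset_valE //; case: ltnP; lia. Qed.

Lemma offset_inj a o o' : o < n -> o' < n -> offset a o = offset a o' -> o = o'.
Proof.
move=> on on' /(congr1 (@nat_of_ord n)).
have an := ltn_ord a; rewrite !offset_valE ?(ltnW on) ?(ltnW on') //.
by case: (ltnP (a + o) n); case: (ltnP (a + o') n); lia.
Qed.

Lemma offset_eq a o o' : o < n -> o' < n ->
  (offset a o == offset a o') = (o == o').
Proof. by move=> on on'; apply/eqP/eqP => [/offset_inj->|->]. Qed.

Lemma offset_onto a x : exists2 o, o < n & x = offset a o.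
Proof.
have [an xn] := (ltn_ord a, ltn_ord x).
exists (if a <= x then x - a else x + n - a); first by case: (leqP a x); lia.
apply: val_inj; rewrite /= offset_valE; last by case: (leqP a x); lia.
by case: (leqP a x) => h; case: (ltnP (a + _)); lia.
Qed.

(** After i steps the visited offsets are 0, ..., [ntrue b i] and, going
backwards from n, n - 1, ..., n - [nfalse b i].  Step i adds the neighbour of
this cyclic interval at one of its two ends; for i = n - 2 only one vertex is
left and both cases give the same offset. *)
Definition new_offset b (i : nat) : nat :=
  if b i then (ntrue b i).+1 else n.-1 - nfalse b i.

Definition pivot a b i : 'I_n := offset a (ntrue b i).
Definition new_vertex a b i : 'I_n := offset a (new_offset b i).

Definition code_edge a b i : {set 'I_n} := [set pivot a b i; new_vertex a b i].

Definition code_graph a b : {set {set 'I_n}} :=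
  [set code_edge a b i | i : 'I_n.-1].

Lemma code_graphP a b e :
  reflect (exists2 i, i < n.-1 & e = code_edge a b i) (e \in code_graph a b).
Proof.
apply: (iffP imsetP) => [[i _ ->]|[i ilt ->]]; first by exists i.
by exists (Ordinal ilt).
Qed.

Lemma new_offset_lt b i : i < n.-1 -> ntrue b i < new_offset b i < n.
Proof. by rewrite /new_offset; have := ntrueDnfalse b i; case: (b i); lia. Qed.

(** All edges after the i-th lie, up to their endpoints, on one side of it:
beyond the new vertex when the pivot advances, and below the new leaf
otherwise.  Both the freshness of the vertices and the absence of crossings rest
on this. *)
Lemma new_offset_fresh b i j : i < j -> j < n.-1 ->
  if b i then (ntrue b i).+1 <= ntrue b j else new_offset b j < new_offset b i.
Proof.
move=> ij jn; have := ntrue_mono b ij; have := nfalse_mono b ij.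
have := ntrueDnfalse b i; have := ntrueDnfalse b j.
rewrite ntrueS nfalseS /new_offset; case: (b i); case: (b j); rewrite /=; lia.
Qed.

Lemma ntrue_lt_new_offset b i j : i <= j -> j < n.-1 -> ntrue b i < new_offset b j.
Proof.
move=> ij jn; have := ntrue_mono b ij; have := new_offset_lt b jn; lia.
Qed.

Lemma new_offset_inj b i j : i < n.-1 -> j < n.-1 -> new_offset b i = new_offset b j -> i = j.
Proof.
wlog: i j / i < j => [H|].
  by case: (ltngtP i j) => // ij im jm eij; [|symmetry]; apply: H.
move=> ij im jm; have := new_offset_fresh b ij jm; have := new_offset_lt b jm.
case bi: (b i) => lo fresh eo; last lia.
have : new_offset b i = (ntrue b i).+1 by rewrite /new_offset bi.
lia.
Qed.

Lemma pivot_neq_new_vertex a b i : i < n.-1 -> pivot a b i != new_vertex a b i.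
Proof. by move=> im; have lo := new_offset_lt b im; rewrite offset_eq; lia. Qed.

Lemma pivotS a b i : pivot a b i.+1 = if b i then new_vertex a b i else pivot a b i.
Proof.
by rewrite /pivot /new_vertex /new_offset ntrueS; case: (b i); rewrite ?addn1 ?addn0.
Qed.

Definition code_pairs a b (i : nat) : seq ('I_n * 'I_n) :=
  rev (mkseq (fun k => (pivot a b k, new_vertex a b k)) i).

Lemma code_pairsS a b i :
  code_pairs a b i.+1 = (pivot a b i, new_vertex a b i) :: code_pairs a b i.
Proof. by rewrite /code_pairs mkseqS rev_rcons. Qed.

Lemma code_pairs_grown a b i : i <= n.-1 -> grown (code_pairs a b i).
Proof.
elim: i => // i IHi im; rewrite code_pairsS /= pivot_neq_new_vertex // IHi ?(ltnW im) // andbT /=.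
apply/allP => e; rewrite mem_rev => /mapP[k]; rewrite mem_iota add0n /= => ki ->.
have km : k < n.-1 by lia.
have lo := new_offset_lt b im; have lok := new_offset_lt b km.
have inj := new_offset_inj (b := b) im km; have lt := ntrue_lt_new_offset b (ltnW ki) im.
by rewrite !offset_eq; lia.
Qed.

Lemma code_pairs_linked a b i : linked (code_pairs a b i).
Proof.
elim: i => // -[//|i]; rewrite [code_pairs a b i.+2]code_pairsS.
rewrite [code_pairs a b i.+1]code_pairsS => IHi; apply/andP; split=> //=.
by rewrite pivotS; case: (b i); rewrite eqxx ?orbT.
Qed.

(** The first i transpositions multiply to the cycle that runs clockwise through
the arc of visited vertices and sends its clockwise end, the pivot, back to its
counterclockwise end. *)
Lemma code_prod a b i o : i <= n.-1 -> o < n ->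
  (\prod_(t <- map (@edge_tperm _) (code_pairs a b i)) t)%g (offset a o) =
  if o < ntrue b i then offset a o.+1
  else if o == ntrue b i then offset a (n - nfalse b i)
  else if o < n - nfalse b i then offset a o
  else offset a o.+1.
Proof.
elim: i o => [|i IHi] o im on.
  rewrite /code_pairs /= big_nil perm1 /nfalse /= subn0 on offsetn.
  by case: eqP => [->|].
rewrite code_pairsS /= big_cons permM /edge_tperm /=.
have lo := new_offset_lt b im; have e := ntrueDnfalse b i.
have -> : tperm (pivot a b i) (new_vertex a b i) (offset a o) =
   offset a (if o == ntrue b i then new_offset b i
             else if o == new_offset b i then ntrue b i else o).
  case: tpermP => [/offset_inj->|/offset_inj->|/eqP + /eqP]; rewrite ?eqxx //; try lia.
    by rewrite ifF //; lia.
  by rewrite !offset_eq; try lia; move=> /negPf-> /negPf->.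
rewrite IHi; try lia; last by repeat case: ifP; lia.
move: lo; rewrite /nfalse !ntrueS -/(nfalse b) /new_offset.
case: (b i) => /= lo; rewrite ?addn0 ?addn1 -?offsetS;
 repeat case: ifP; move=> *; try lia; try (congr offset; lia).
Qed.

End Offsets.

(** * The factorization of a code *)

Lemma eq_set2 (T : finType) (x y z t : T) : x != y -> [set x; y]%SET = [set z; t]%SET ->
  (x = z /\ y = t) \/ (x = t /\ y = z).
Proof.
move=> xy E; have := set21 x y; have := set22 x y; rewrite E.
by case/set2P=> yE /set2P[] xE; move: xy; rewrite xE yE ?eqxx //; [right|left].
Qed.

Lemma tperm_set2 (T : finType) (x y z t : T) : x != y ->
  (tperm x y == tperm z t) = ([set x; y] == [set z; t]).
Proof.
move=> xy; apply/eqP/eqP => E.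
  apply/setP=> u; rewrite !inE; have := congr1 (fun s : {perm T} => s u == u) E.
  have zt : z != t.
    apply: contra xy => /eqP zt; move: E; rewrite zt tperm1.
    by move/permP/(_ x); rewrite tpermL perm1 => ->.
  case: tpermP => [->|->|/eqP/negPf-> /eqP/negPf->];
  case: tpermP => [->|->|/eqP/negPf-> /eqP/negPf->];
  by rewrite ?eqxx ?orbT // ?(eq_sym y) ?(eq_sym t) ?(negPf xy) ?(negPf zt) //.
have := set21 x y; have := set22 x y; rewrite !E !inE.
case/pred2P=> yE /pred2P[] xE; move: xy; rewrite xE yE ?eqxx // => _.
exact: tpermC.
Qed.

(** Two distinct transpositions that do not commute determine their common
letter. *)
Lemma tperm_meet (T : finType) (p c d x y z : T) : p != c -> p != d -> c != d ->
  tperm p c = tperm x y -> tperm p d = tperm x z -> x = p.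
Proof.
move=> pc pd cd /eqP + /eqP; rewrite !tperm_set2 // => /eqP E /eqP F.
move: (set21 x y) (set21 x z); rewrite -E -F.
case/set2P=> [//|xc] /set2P[//|xd].
by move: cd; rewrite -xc -xd eqxx.
Qed.

Section Words.
Variable n : nat.
Implicit Types (a x : 'I_n) (b : nat -> bool).

Definition code_word_seq a b : seq {perm 'I_n} :=
  map (@edge_tperm _) (rev (code_pairs a b n.-1)).

Lemma size_code_word a b : size (code_word_seq a b) == n.-1.
Proof. by rewrite size_map size_rev /code_pairs size_rev size_mkseq. Qed.

Definition code_word a b : n.-1.-tuple {perm 'I_n} := Tuple (size_code_word a b).

Lemma nth_code_word a b i : i < n.-1 ->
  nth 1%g (code_word a b) i = tperm (pivot a b i) (new_vertex a b i).
Proof.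
move=> im; rewrite /= /code_word_seq /code_pairs revK -map_comp.
by rewrite (nth_map 0) ?size_iota // nth_iota.
Qed.

Lemma code_wordP a b t :
  reflect (exists2 i, i < n.-1 & t = tperm (pivot a b i) (new_vertex a b i))
          (t \in val (code_word a b)).
Proof.
apply: (iffP (nthP 1%g)); rewrite (eqP (size_code_word a b)) => -[i im].
  by rewrite nth_code_word // => <-; exists i.
by move=> ->; exists i; rewrite ?nth_code_word.
Qed.

Lemma code_word_factorization a b : 1 < n -> code_word a b \in cycle_factorizations n.
Proof.
move=> n1; rewrite inE; apply/andP; split.
  apply/allP => t /code_wordP[i im ->]; apply/existsP; exists (pivot a b i).
  by apply/existsP; exists (new_vertex a b i); rewrite pivot_neq_new_vertex /=.
rewrite /= /code_word_seq -map_rev revK; apply/eqP/permP => x.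
have [o on ->] := offset_onto a x.
rewrite code_prod // permE -offsetS; have e := ntrueDnfalse b n.-1.
have [//|h] := ltnP o; case: eqP => [->|ne]; last by rewrite ifF //; lia.
by congr offset; lia.
Qed.

Lemma graph_of_code_word a b : graph_of (code_word a b) = code_graph a b.
Proof.
apply/setP=> e; rewrite inE; apply/existsP/code_graphP => [[x /existsP[y]]|].
  case/and3P=> xy /code_wordP[i im E] /eqP->; exists i => //.
  by apply/eqP; rewrite -tperm_set2 // E.
case=> i im ->; exists (pivot a b i); apply/existsP; exists (new_vertex a b i).
rewrite pivot_neq_new_vertex // eqxx andbT /=; by apply/code_wordP; exists i.
Qed.

(** A factorization whose graph is that of the code has the same set of
transpositions, hence, by counting, is a rearrangement of the word. *)
Lemma word_of_code a b : 1 < n -> word_of (code_graph a b) = code_word a b.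
Proof.
move=> n1; rewrite /word_of; case: pickP => [w|none]; last first.
  by move: (none (code_word a b)); rewrite code_word_factorization // graph_of_code_word eqxx.
rewrite inE -andbA => /and3P[_ /eqP prodw /eqP Gw] /=.
apply: val_inj; apply: (can_inj (@revK _)) => /=.
rewrite /code_word_seq -map_rev revK.
apply: grown_factorization_uniq.
- exact: code_pairs_grown.
- exact: code_pairs_linked.
- rewrite perm_sym -(revK (code_pairs a b n.-1)) map_rev -/(code_word_seq a b).
  rewrite perm_rev perm_sym perm_rev perm_sym.
  have uw : uniq (code_word_seq a b).
    by rewrite /code_word_seq map_rev rev_uniq grown_uniq // code_pairs_grown.
  have sub : {subset code_word_seq a b <= val w}.
    move=> t /code_wordP[i im ->].
    have : code_edge a b i \in graph_of w by rewrite Gw; apply/code_graphP; exists i.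
    rewrite inE => /existsP[x /existsP[y /and3P[xy tw]]].
    by rewrite -tperm_set2 ?pivot_neq_new_vertex // => /eqP->.
  have le : size (val w) <= size (code_word_seq a b).
    by rewrite size_tuple (eqP (size_code_word a b)).
  apply: uniq_perm => //; first exact: leq_size_uniq le.
  by case: (uniq_min_size uw sub le).
- rewrite prodw; have := code_word_factorization a b n1.
  by rewrite inE => /andP[_ /eqP<-]; rewrite /= /code_word_seq -map_rev revK.
Qed.

End Words.

(** * Descents of a code *)

Section Descents.
Variable n : nat.
Implicit Types (a x : 'I_n) (b : nat -> bool).

(** The other endpoint of edge i, seen from the pivot of step i + 1, which is
the common letter of edges i and i + 1. *)
Definition previous a b i : 'I_n := if b i then pivot a b i else new_vertex a b i.

Definition descent a b (i : nat) : bool := new_vertex a b i.+1 < previous a b i.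

(** The arc visited in the first i steps, from label a - [nfalse b i] to label
a + [ntrue b i], does not pass from the last label to the first one. *)
Definition straight a b (i : nat) : bool :=
  (nfalse b i <= a) && (a + ntrue b i < n).

Lemma straightW a b i j : i <= j -> straight a b j -> straight a b i.
Proof.
by move=> ij /andP[]; have := ntrue_mono b ij; have := nfalse_mono b ij; rewrite /straight; lia.
Qed.

Lemma nth_code_word_previous a b i : i < n.-1 ->
  nth 1%g (code_word a b) i = tperm (pivot a b i.+1) (previous a b i).
Proof.
move=> im; rewrite nth_code_word // pivotS /previous.
by case: (b i) => //; rewrite tpermC.
Qed.

Lemma pivot_neighbours a b i : i.+1 < n.-1 ->
  [/\ pivot a b i.+1 != previous a b i, pivot a b i.+1 != new_vertex a b i.+1 &
      previous a b i != new_vertex a b i.+1].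
Proof.
move=> im1; have im0 : i < n.-1 by lia.
split.
- rewrite pivotS /previous.
  by case: (b i); rewrite ?pivot_neq_new_vertex // eq_sym pivot_neq_new_vertex.
- exact: pivot_neq_new_vertex.
have lt := ntrue_lt_new_offset b (leqnSn i) im1.
have lo := new_offset_lt b im1; have lo0 := new_offset_lt b im0.
have inj := new_offset_inj im0 im1.
rewrite /previous; case: (b i); rewrite offset_eq; try lia.
by apply/eqP=> /inj; lia.
Qed.

(** The step w during which the arc starts to pass from the last label to the
first one; by convention w is the last step, n - 2, if this has not happened
earlier. *)
Lemma exists_wrap a b : exists2 w, w <= n.-2 & straight a b w /\ (w < n.-2 -> ~~ straight a b w.+1).
Proof.
have s0 : straight a b 0 by rewrite /straight addn0 ltn_ord.
elim: n.-2 => [|k [w wk [sw nsw]]]; first by exists 0.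
have [sk|nsk] := boolP (straight a b k.+1); first by exists k.+1; rewrite ?ltnn.
exists w; first lia.
by split=> // _; have [/nsw//|kw] := ltnP w k; have -> : w = k by lia.
Qed.

Lemma Des_code a b (i : 'I_n.-2) : (i \in Des_word (code_word a b)) = descent a b i.
Proof.
have im := ltn_ord i; have im1 : i.+1 < n.-1 by lia.
have im0 : i < n.-1 by lia.
have [pc pd cd] := pivot_neighbours a b im1.
rewrite inE nth_code_word_previous // nth_code_word //.
set d := new_vertex a b i.+1; set p := pivot a b i.+1; set c := previous a b i.
rewrite -/p -/c -/d in pc pd cd.
apply/existsP/idP => [[x /existsP[y /existsP[z /and3P[/eqP E /eqP F zy]]]]|lt].
  have xp := tperm_meet pc pd cd E F; rewrite xp in E F.
  have yc : y = c by rewrite -[LHS](tpermL p) -E tpermL.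
  have zd : z = d by rewrite -[LHS](tpermL p) -F tpermL.
  by rewrite /descent -/c -/d -yc -zd.
by exists p; apply/existsP; exists c; apply/existsP; exists d; rewrite !eqxx.
Qed.

Lemma pivot_val a b i : i < n.-1 ->
  nat_of_ord (pivot a b i) = (if a + ntrue b i < n then a + ntrue b i else a + ntrue b i - n).
Proof. by move=> im; rewrite offset_valE //; have := new_offset_lt b im; lia. Qed.

Lemma new_vertex_val a b i : i < n.-1 ->
  nat_of_ord (new_vertex a b i) =
  (if a + new_offset n b i < n then a + new_offset n b i else a + new_offset n b i - n).
Proof. by move=> im; rewrite offset_valE //; have := new_offset_lt b im; lia. Qed.

(** While the arc is straight, all old vertices have labels below the pivot,
so there is a descent unless the next vertex is above the pivot.  This happens
when the pivot advances without passing the last label, or when a leaf is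
reached past the first label. *)
Lemma descent_straight a b i : i.+1 < n.-1 -> straight a b i.+1 ->
  descent a b i = (b i.+1 (+) straight a b i.+2).
Proof.
move=> im; have im0 : i < n.-1 by lia.
have an := ltn_ord a; have e := ntrueDnfalse b i.
have := pivot_val a b im0; have := new_vertex_val a b im0; have := new_vertex_val a b im.
rewrite /descent /previous (fun_if (@nat_of_ord n)) /straight /new_offset !ntrueS !nfalseS.
move: (nat_of_ord (new_vertex a b i.+1)) => z; move: (nat_of_ord (new_vertex a b i)) => y.
move: (nat_of_ord (pivot a b i)) => x.
move: (ntrue b i) (nfalse b i) (nat_of_ord a) an e => s l t an e.
case: (b i) => /=; case: (b i.+1) => /=; rewrite ?addn0 ?addn1;
  do 3! case: ifP; move=> *; apply/idP/idP; lia.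
Qed.

(** Once the arc passes through the junction of the labels, the next vertex has a
larger label than the pivot, so there is a descent unless the previous vertex was
below the pivot, that is, unless the pivot has advanced to its place within the
low labels.  Right after the wrapping step the previous vertex carries the largest
label and a descent is forced. *)
Lemma descent_wrapped a b i : i.+1 < n.-1 -> ~~ straight a b i.+1 ->
  descent a b i = straight a b i || ~~ b i.
Proof.
move=> im; have im0 : i < n.-1 by lia.
have an := ltn_ord a; have e := ntrueDnfalse b i.
have := pivot_val a b im0; have := new_vertex_val a b im0; have := new_vertex_val a b im.
rewrite /descent /previous (fun_if (@nat_of_ord n)) /straight /new_offset !ntrueS !nfalseS.
move: (nat_of_ord (new_vertex a b i.+1)) => z; move: (nat_of_ord (new_vertex a b i)) => y.
move: (nat_of_ord (pivot a b i)) => x.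
move: (ntrue b i) (nfalse b i) (nat_of_ord a) an e => s l t an e.
case: (b i) => /=; case: (b i.+1) => /=; rewrite ?addn0 ?addn1;
  do 3! case: ifP; move=> *; apply/idP/idP; lia.
Qed.

End Descents.

(** * Chords of the regular polygon *)

Section Plane.
Local Open Scope ring_scope.
Variable R : realType.
Implicit Types p q r t : R^o * R^o.

(** Twice the signed area of the triangle p q r. *)
Definition cross p q r : R :=
  (q.1 - p.1) * (r.2 - p.2) - (q.2 - p.2) * (r.1 - p.1).

Lemma cross_rot p q r : cross p q r = cross q r p.
Proof. by rewrite /cross; ring. Qed.

Lemma cross_swap p q r : cross p q r = - cross p r q.
Proof. by rewrite /cross; ring. Qed.

Lemma cross_end p q : cross p q p = 0.
Proof. by rewrite /cross; ring. Qed.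

Lemma open_segmentP p q z :
  open_segment p q z <-> exists s : R, [/\ 0 < s, s < 1,
     z.1 = (1 - s) * p.1 + s * q.1 & z.2 = (1 - s) * p.2 + s * q.2].
Proof.
split=> [[s /= + <-]|[s [s0 s1 z1 z2]]].
  by rewrite in_itv /= => /andP[s0 s1]; exists s.
exists s; first by rewrite /= in_itv /= s0 s1.
by rewrite [z]surjective_pairing z1 z2.
Qed.

Lemma open_segmentC p q : open_segment p q = open_segment q p.
Proof.
suff sub p' q' : (open_segment p' q' `<=` open_segment q' p')%classic.
  by apply/seteqP; split; apply: sub.
move=> z /open_segmentP[s [s0 s1 z1 z2]]; apply/open_segmentP; exists (1 - s).
by split; rewrite ?z1 ?z2; try lra; ring.
Qed.

Lemma open_segment_disjoint p q r t :
  0 <= cross p q r -> 0 < cross p q t ->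
  (open_segment p q `&` open_segment r t = set0)%classic.
Proof.
move=> r0 t0; apply/seteqP; split=> // z [].
move=> /open_segmentP[s [s0 s1 z1 z2]] /open_segmentP[u [u0 u1 w1 w2]].
have e0 : cross p q z = 0 by rewrite /cross z1 z2; ring.
have : cross p q z = (1 - u) * cross p q r + u * cross p q t.
  by rewrite /cross w1 w2; ring.
rewrite e0 => e; have := mulr_gt0 u0 t0.
have u1' : 0 <= 1 - u by lra.
have := mulr_ge0 u1' r0; lra.
Qed.

(** The intersection point of the two lines is given by the ratios of signed
areas, and the sign conditions place it inside both segments. *)
Lemma open_segment_cross p q r t :
    0 < cross p q r -> cross p q t < 0 -> cross r t p < 0 -> 0 < cross r t q ->
  ((open_segment p q `&` open_segment r t) !=set0)%classic.
Proof.
set A := cross p q r; set B := cross p q t; set C := cross r t p; set D := cross r t q.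
move=> A0 B0 C0 D0.
have K : A - B = D - C by rewrite /A /B /C /D /cross; ring.
have K0 : A - B != 0 by lra.
pose s := A / (A - B); pose u := - C / (A - B).
have AB : 0 < A - B by lra.
have s01 : 0 < s < 1.
  by rewrite /s divr_gt0 //= ltr_pdivrMr // mul1r; lra.
have u01 : 0 < u < 1.
  by rewrite /u divr_gt0 //= ?oppr_gt0 // ltr_pdivrMr // mul1r; lra.
exists ((1 - u) * p.1 + u * q.1, (1 - u) * p.2 + u * q.2).
split; apply/open_segmentP; [exists u|exists s]; split; rewrite /=; try lra; move: K0;
  rewrite /u /s /A /B /C /cross => K0; by field.
Qed.

(** The angles are doubled because the area is a product of sines of half the
central angles. *)
Lemma cross_circle (x y z : R) :
  cross (cos (x *+ 2), sin (x *+ 2)) (cos (y *+ 2), sin (y *+ 2))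
    (cos (z *+ 2), sin (z *+ 2)) =
  4 * sin (y - x) * sin (z - y) * sin (z - x).
Proof.
rewrite /cross /= !mulr2n !cosD !sinD !sinN !cosN.
have hx := cos2Dsin2 x; have hy := cos2Dsin2 y; have hz := cos2Dsin2 z.
move: (cos x) (sin x) (cos y) (sin y) (cos z) (sin z) hx hy hz => cx sx cy sy cz sz.
pose w (c s d e : R) : R := (c * c - s * s) * (d * e *+ 2) - (d * d - e * e) * (c * s *+ 2).
move=> hx hy hz.
(* each doubled sine is made homogeneous by a factor cos^2 + sin^2 of the third angle *)
transitivity (w cx sx cy sy * (cz ^+ 2 + sz ^+ 2) + w cy sy cz sz * (cx ^+ 2 + sx ^+ 2)
   + w cz sz cx sx * (cy ^+ 2 + sy ^+ 2)); last by rewrite /w; ring.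
by rewrite hx hy hz /w; ring.
Qed.

Variable n : nat.

(** Reducing a + o modulo n changes the angle by a full turn, so orientations
can be computed from offsets, whatever the starting vertex. *)
Lemma ngon_vertex_offset (a : 'I_n) o : (o < n)%N ->
  ngon_vertex R (offset a o) =
  let h := - (pi * (a + o)%:R / n%:R) in (cos (h *+ 2), sin (h *+ 2)).
Proof.
move=> on; rewrite /ngon_vertex /= offset_valE; last exact: ltnW.
have n0 : n%:R != 0 :> R by rewrite pnatr_eq0; lia.
case: (ltnP (a + o) n) => h.
  suff -> : - (2 * pi * (a + o)%:R / n%:R) = - (pi * (a + o)%:R / n%:R) *+ 2 :> R by [].
  by ring.
rewrite natrB //.
have -> : - (2 * pi * ((a + o)%:R - n%:R) / n%:R) =
   - (pi * (a + o)%:R / n%:R) *+ 2 + pi *+ 2 :> R by field.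
by rewrite cosD2pi sinD2pi.
Qed.

Lemma cross_offset (a : 'I_n) o1 o2 o3 : (o1 < o2)%N -> (o2 < o3)%N -> (o3 < n)%N ->
  cross (ngon_vertex R (offset a o1)) (ngon_vertex R (offset a o2))
        (ngon_vertex R (offset a o3)) < 0.
Proof.
move=> lt12 lt23 lt3; rewrite !ngon_vertex_offset ?cross_circle; try lia.
have n0 : n%:R != 0 :> R by rewrite pnatr_eq0; lia.
have ngt0 : 0 < n%:R :> R by rewrite ltr0n; lia.
have key i j : (i < j)%N -> (j < n)%N ->
    sin (- (pi * (a + j)%:R / n%:R) - - (pi * (a + i)%:R / n%:R) : R) < 0.
  move=> ij jn.
  have -> : - (pi * (a + j)%:R / n%:R) - - (pi * (a + i)%:R / n%:R) =
      - (pi * ((j - i)%:R / n%:R)) :> R.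
    by rewrite natrB ?(ltnW ij) // !natrD; field.
  rewrite sinN oppr_lt0 sin_gt0_pi //; apply/andP; split.
    by rewrite mulr_gt0 ?pi_gt0 // divr_gt0 // ltr0n; lia.
  rewrite -[ltRHS]mulr1 ltr_pM2l ?pi_gt0 // ltr_pdivrMr // mul1r ltr_nat; lia.
have k12 := key o1 o2 lt12 (ltn_trans lt23 lt3).
have k23 := key o2 o3 lt23 lt3.
have k13 := key o1 o3 (ltn_trans lt12 lt23) lt3.
by rewrite nmulr_llt0 // -mulrA mulr_gt0 // nmulr_rgt0.
Qed.

End Plane.

(** * Trees and paths *)

Section GraphLemmas.
Variable T : finType.
Implicit Types (E : {set {set T}}) (x y p : T).

Lemma adjC E : symmetric (adj E).
Proof. by move=> x y; rewrite /adj finset.setUC. Qed.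

Lemma connect_adjC E : connect_sym (adj E).
Proof. exact/sym_connect_sym/adjC. Qed.

(** A cycle through the pendant vertex x would have to enter and leave it by
the same edge. *)
Lemma acyclic_pendant E p x : (forall e, e \in E -> x \notin e) ->
  acyclic_graph E -> acyclic_graph (([set p; x] |: E)%SET).
Proof.
move=> xE acE s s2 us; apply/negP => cs.
have adj_x y : adj ([set p; x] |: E)%SET x y -> y = p \/ y = x.
  rewrite /adj => /setU1P[|/xE]; last by rewrite set21.
  by move/setP/(_ y); rewrite set22 => /esym/set2P.
have [xs|xNs] := boolP (x \in s); last first.
  have /negP := acE s s2 us; apply; apply: (sub_in_cycle (P := [pred y | y \in s])) cs.
    move=> y z; rewrite !inE => ys zs; rewrite /adj => /setU1P[E1|//].
    by have := set22 p x; rewrite -E1 => /set2P[] xE'; move: xNs; rewrite xE' ?ys ?zs.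
  by apply/allP.
have [i s' rot_s] := rot_to xs.
move: s2 us cs; rewrite -(size_rot i) -(rot_uniq i) -(rot_cycle i) rot_s.
case: s' {rot_s} => [|y s'] //= s2; rewrite rcons_path => /andP[xNs /andP[yNs _]].
case/andP=> xy /andP[_]; rewrite adjC => lx.
have yp : y = p by case: (adj_x _ xy) => // yx; rewrite yx inE eqxx in xNs.
have lp : last y s' = p.
  by case: (adj_x _ lx) => // lE; rewrite -lE mem_last in xNs.
case: s' s2 yNs lp {xNs lx} => [//|z s'] _ yNs /= lp.
by rewrite yp -lp mem_last in yNs.
Qed.

Lemma grown_acyclic (es : seq (T * T)) : grown es ->
  acyclic_graph [set:: [seq [set e.1; e.2]%SET | e <- es]]%SET.
Proof.
elim: es => [_ s|e r IHr /= /and3P[ne /allP fresh /IHr ac]].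
  case: s => [|x [|y s]] //= _ _; apply/negP => /andP[].
  by rewrite /adj inE.
rewrite set_cons; apply: acyclic_pendant => // f.
rewrite inE => /mapP[g /fresh/andP[n1 n2] ->].
by rewrite !inE negb_or n1 n2.
Qed.

Lemma path_edges_traject (f : T -> T) x m e :
  reflect (exists2 o, o < m & e = [set iter o f x; iter o.+1 f x]%SET)
          (e \in path_edges (traject f x m.+1)).
Proof.
rewrite /path_edges inE.
have -> : behead (traject f x m.+1) = traject f (f x) m by [].
apply: (iffP mapP) => [[[y z] yz ->]|[o om ->]].
  have [k] := nthP (x, x) yz; rewrite size_zip !size_traject => km.
  rewrite nth_zip_cond size_zip !size_traject km.
  rewrite (set_nth_default x) ?size_traject; last lia.
  rewrite nth_traject; last lia.
  rewrite (set_nth_default (f x)) ?size_traject; last lia.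
  rewrite nth_traject; last lia.
  by case=> <- <-; exists k; [lia|rewrite iterSr].
exists (iter o f x, iter o.+1 f x) => //.
apply/(nthP (x, x)); exists o; first by rewrite size_zip !size_traject; lia.
rewrite nth_zip_cond size_zip !size_traject ifT; last lia.
  rewrite (set_nth_default x) ?size_traject; last lia.
  rewrite nth_traject; last lia.
  rewrite (set_nth_default (f x)) ?size_traject; last lia.
  by rewrite nth_traject -?iterSr.
Qed.

End GraphLemmas.

(** * The graph of a code is a convex caterpillar *)

Lemma traject_offset n (a : 'I_n) k :
  traject (@ordS n) a k = [seq offset a o | o <- iota 0 k].
Proof.
apply: (@eq_from_nth _ a) => [|i]; rewrite size_traject ?size_map ?size_iota // => ik.
by rewrite nth_traject // (nth_map 0) ?size_iota // nth_iota.
Qed.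

Lemma mem_traject_offset n (a : 'I_n) k o : k <= n -> o < n ->
  (offset a o \in traject (@ordS n) a k) = (o < k).
Proof.
move=> kn on; apply/trajectP/idP => [[i ik /offset_inj->]|ok]; try lia.
by exists o.
Qed.

Section CodeCaterpillar.
Variables (n : nat) (a : 'I_n) (b : nat -> bool).
Hypotheses (n3 : 2 < n) (b0 : b 0 = false).

Lemma code_edge_inj i j : i < n.-1 -> j < n.-1 -> code_edge a b i = code_edge a b j -> i = j.
Proof.
wlog: i j / i < j => [H|].
  by case: (ltngtP i j) => // ij im jm eij; [|symmetry]; apply: H.
(* the new vertex of edge j cannot belong to the earlier edge i *)
move=> ij im jm E; have := set22 (pivot a b j) (new_vertex a b j).
have lt := ntrue_lt_new_offset b (ltnW ij) jm.
have [loi loj] := (new_offset_lt b im, new_offset_lt b jm).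
rewrite -/(code_edge a b j) -E => /set2P[] /offset_inj eo; first lia.
by apply/esym/(new_offset_inj jm im)/eo; lia.
Qed.

Let F := code_graph a b.

Lemma code_graph_simple : simple_graph F.
Proof. by move=> e /code_graphP[i im ->]; rewrite cards2 pivot_neq_new_vertex. Qed.

Lemma code_graph_acyclic : acyclic_graph F.
Proof.
have := grown_acyclic (code_pairs_grown a b (leqnn _)).
suff -> : [set:: [seq [set e.1; e.2]%SET | e <- code_pairs a b n.-1]]%SET = F by [].
apply/setP=> e; rewrite inE; apply/mapP/code_graphP => [[f + ->]|[i im ->]].
  by rewrite mem_rev => /mapP[i]; rewrite mem_iota => im ->; exists i.
exists (pivot a b i, new_vertex a b i) => //; rewrite mem_rev; apply/mapP; exists i => //.
by rewrite mem_iota.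
Qed.

Lemma code_graph_adj i : i < n.-1 -> adj F (pivot a b i) (new_vertex a b i).
Proof. by move=> im; apply/code_graphP; exists i. Qed.

Lemma code_graph_connected : connected_graph F.
Proof.
suff conn i o : i <= n.-1 -> o < n -> (o <= ntrue b i) || (n - nfalse b i <= o) ->
    connect (adj F) a (offset a o).
  move=> x y; have [o on ->] := offset_onto a x; have [o' on' ->] := offset_onto a y.
  have e := ntrueDnfalse b n.-1.
  apply: (@connect_trans _ _ a); last by apply: (conn n.-1) => //; lia.
  by rewrite connect_adjC; apply: (conn n.-1) => //; lia.
elim: i o => [|i IHi] o im on ho.
  have -> : o = 0 by move: ho; rewrite /nfalse /=; lia.
  exact: connect0.
have e := ntrueDnfalse b i; have lo := new_offset_lt b im.
have [->|ne] := eqVneq o (new_offset n b i).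
  apply: (@connect_trans _ _ (pivot a b i)); last exact/connect1/code_graph_adj.
  by apply: IHi; lia.
apply: IHi; try lia; move: ho ne; rewrite ntrueS nfalseS /new_offset.
case: (b i) => /=; lia.
Qed.

Let m := ntrue b n.-2.

Lemma spine_length_lt : m < n.-1.
Proof. have := ntrueDnfalse b n.-2; rewrite /m; lia. Qed.

(** A vertex that is a pivot after the first step lies on the edges before and
after that step.  The initial vertex is one of them because the first letter is
[false].  Every other vertex lies only on the edge that reached it. *)
Lemma code_graph_degree o : o < n -> (degree F (offset a o) != 1) = (o <= m).
Proof.
move=> on; have mE := ntrueDnfalse b n.-2; rewrite -/m in mE.
have [om|om] := leqP o m.
  have [i [i0 im io]] : exists i, [/\ 0 < i, i < n.-1 & ntrue b i = o].
    have [->|ne] := eqVneq o m; first by exists n.-2; split=> //; lia.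
    have [|i [im io bi]] := @ntrue_onto b o n.-2; first by rewrite -/m; lia.
    by exists i; split; [case: i bi {io im}; rewrite ?b0|lia|].
  have im1 : i.-1 < n.-1 by lia.
  have ne : code_edge a b i.-1 != code_edge a b i.
    by apply/eqP=> /code_edge_inj; lia.
  suff : 1 < degree F (offset a o) by case: eqP => [->|].
  rewrite /degree -[2](_ : #|[set code_edge a b i.-1; code_edge a b i]%SET| = _); last first.
    by rewrite cards2 ne.
  apply/subset_leq_card/fintype.subsetP => e /set2P[] ->; rewrite inE; apply/andP; split.
  - by apply/code_graphP; exists i.-1.
  - have := pivotS a b i.-1; rewrite prednK // /pivot io => ->.
    by rewrite /code_edge; case: (b _); rewrite ?set21 ?set22.
  - by apply/code_graphP; exists i.
  - by rewrite /code_edge /pivot io set21.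
have [i im io] : exists2 i, i < n.-1 & new_offset n b i = o.
  have [lt|ge] := ltnP (n.-1 - o) (nfalse b n.-2).
    have [i [im io bi]] := nfalse_onto lt; exists i; first lia.
    by rewrite /new_offset (negPf bi) io; lia.
  exists n.-2; first lia.
  by rewrite /new_offset -/m; case: (b _); lia.
apply/negbTE; rewrite negbK /degree; apply/eqP.
rewrite -(cards1 (code_edge a b i)); congr #|pred_of_set _|.
apply/setP=> e; rewrite !inE; apply/andP/eqP => [[/code_graphP[j jm ->]]|->]; last first.
  by split; [apply/code_graphP; exists i|rewrite /code_edge -io set22].
have [loi loj] := (new_offset_lt b im, new_offset_lt b jm).
case/set2P=> /offset_inj eo; last by rewrite (new_offset_inj (b := b) im jm) // io eo //; lia.
by have := @ntrue_mono b j n.-2; rewrite -/m; lia.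
Qed.

Lemma code_graph_spine : spine_vertices F = [set:: traject (@ordS n) a m.+1]%SET.
Proof.
apply/setP=> x; have [o on ->] := offset_onto a x.
by rewrite !finset.in_set code_graph_degree // mem_traject_offset //; have := spine_length_lt; lia.
Qed.

Lemma code_graph_spine_edges : spine_edges F = path_edges (traject (@ordS n) a m.+1).
Proof.
have mE := ntrueDnfalse b n.-2; rewrite -/m in mE.
have ml := spine_length_lt.
have spE o : o < n -> (offset a o \in spine_vertices F) = (o <= m).
  by move=> on; rewrite inE code_graph_degree.
apply/setP=> e; rewrite inE; apply/andP/path_edges_traject.
  case=> /code_graphP[i im ->]; have lo := new_offset_lt b im.
  move/fintype.subsetP/(_ _ (set22 _ _)); rewrite spE; last lia.
  have mono := @nfalse_mono b i n.-2.
  rewrite /code_edge /pivot /new_vertex /new_offset; case: (b i) => [om|]; last lia.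
  by exists (ntrue b i).
case=> o om ->; have [i [im io bi]] := ntrue_onto om; split.
  by apply/code_graphP; exists i; [lia|rewrite /code_edge /pivot /new_vertex /new_offset bi io].
apply/fintype.subsetP => x /set2P[] ->; rewrite -?iterS -/(offset _ _) spE; lia.
Qed.

Variable R : realType.

(** Both endpoints of a later edge lie weakly on the same side of an earlier
one, and at least one lies strictly on it. *)
Lemma code_graph_noncrossing : noncrossing R F.
Proof.
pose seg i := open_segment (ngon_vertex R (pivot a b i)) (ngon_vertex R (new_vertex a b i)).
have segE x y i : i < n.-1 -> [set x; y]%SET = code_edge a b i ->
    open_segment (ngon_vertex R x) (ngon_vertex R y) = seg i.
  move=> im /esym /(eq_set2 (pivot_neq_new_vertex a b im))[] [<- <-] //.
  exact: open_segmentC.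
have disj i j : i < j -> j < n.-1 -> (seg i `&` seg j = set0)%classic.
  move=> ij jm; have im : i < n.-1 by lia.
  have [loi loj] := (new_offset_lt b im, new_offset_lt b jm).
  have := ntrue_mono b (ltnW ij); have := new_offset_fresh b ij jm.
  rewrite /seg; case bi: (b i) => fr mono.
    have loi' : new_offset n b i = (ntrue b i).+1 by rewrite /new_offset bi.
    have pos o : new_offset n b i < o -> o < n -> (0 < cross (ngon_vertex R (new_vertex a b i))
        (ngon_vertex R (pivot a b i)) (ngon_vertex R (offset a o)))%R.
      by move=> lo on; rewrite cross_rot cross_swap oppr_gt0 cross_offset; lia.
    rewrite open_segmentC; apply: open_segment_disjoint; last by apply: pos; lia.
    have [lt|ge] := ltnP (new_offset n b i) (ntrue b j); first by apply/ltW/pos; lia.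
    by rewrite /new_vertex (_ : new_offset n b i = ntrue b j) ?cross_end //; lia.
  have pos o : ntrue b i < o -> o < new_offset n b i -> (0 < cross (ngon_vertex R (pivot a b i))
      (ngon_vertex R (new_vertex a b i)) (ngon_vertex R (offset a o)))%R.
    by move=> lo on; rewrite cross_swap oppr_gt0 cross_offset; lia.
  apply: open_segment_disjoint; last by apply: pos; lia.
  have [lt|ge] := ltnP (ntrue b i) (ntrue b j); first by apply/ltW/pos; lia.
  by rewrite /pivot (_ : ntrue b i = ntrue b j) ?cross_end //; lia.
move=> x y z t /code_graphP[i im E] /code_graphP[j jm E']; rewrite E E'.
rewrite (segE _ _ _ im E) (segE _ _ _ jm E') => ne.
have : i != j by apply: contra ne => /eqP->.
rewrite neq_ltn => /orP[] ij; first exact: disj.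
by rewrite setIC disj.
Qed.

Lemma code_graph_convex : convex_caterpillar R F.
Proof.
have ml := spine_length_lt.
split; [split; [split|]| |].
- exact: code_graph_simple.
- exact: code_graph_connected.
- exact: code_graph_acyclic.
- exists (traject (@ordS n) a m.+1); rewrite code_graph_spine code_graph_spine_edges; split=> //.
  rewrite traject_offset map_inj_in_uniq ?iota_uniq // => i j; rewrite !mem_iota => im jm.
  by apply: offset_inj; lia.
- exact: code_graph_noncrossing.
- by exists a, m; rewrite ?code_graph_spine_edges //; lia.
Qed.

End CodeCaterpillar.

(** * Every convex caterpillar has a code *)

(** Here [ed] is the adjacency of offsets in a caterpillar with spine 0, ..., m.
The code is read off greedily: take the next leaf if it hangs at the current
pivot, and advance otherwise.  Since edges do not cross, leaves met in decreasing
order hang at weakly increasing spine vertices, so no leaf is left behind when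
the pivot advances. *)
Lemma greedy_code (n m : nat) (ed : rel nat) :
    m < n -> symmetric ed ->
    (forall o, o < m -> ed o o.+1) ->
    (forall o o', o < o' -> o' <= m -> ed o o' -> o' = o.+1) ->
    (forall o, m < o -> o < n -> exists2 r, r <= m & ed o r) ->
    (forall o r r', m < o -> o < n -> r < n -> r' < n -> ed o r -> ed o r' -> r = r') ->
    (forall o1 o2 o3 o4, o1 < o2 -> o2 < o3 -> o3 < o4 -> o4 < n ->
       ed o1 o3 -> ed o2 o4 -> False) ->
    (exists2 y, m < y < n & ed 0 y) ->
  exists b, [/\ b 0 = false,
    forall i, i < n.-1 -> ed (ntrue b i) (new_offset n b i) &
    forall o o', o < o' -> o' < n -> ed o o' ->
      exists i, [/\ i < n.-1, ntrue b i = o & new_offset n b i = o']].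
Proof.
move=> mn edC sp sp' lf lfu nc [y my ey].
pose go k sk := ~~ ((m < n.-1 - (k - sk)) && ed sk (n.-1 - (k - sk))).
pose fix s k := if k is k'.+1 then s k' + go k' (s k') else 0.
pose b k := go k (s k).
have sE k : ntrue b k = s k by elim: k => //= k ->.
have bE k : b k = ~~ ((m < n.-1 - nfalse b k) && ed (ntrue b k) (n.-1 - nfalse b k)).
  rewrite {1}/b /go -!sE; have e := ntrueDnfalse b k.
  by have -> : k - ntrue b k = nfalse b k by lia.
have b0 : b 0 = false.
  rewrite bE /= /nfalse /= subn0; apply/negbTE; rewrite negbK.
  have mn1 : m < n.-1 by lia.
  rewrite mn1 /=; have [||r rm er] := lf n.-1; try lia.
  have [yE|ne] := eqVneq y n.-1; first by rewrite -yE.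
  case: r rm er => [|r] rm er; first by rewrite edC.
  by case: (@nc 0 r.+1 y n.-1); rewrite ?[ed _ n.-1]edC //; lia.
(* the third clause: the leaves still to come hang at or after the pivot *)
have inv i : i <= n.-1 ->
  [/\ ntrue b i <= m, nfalse b i <= n.-1 - m,
      forall o r, m < o -> o <= n.-1 - nfalse b i -> r < n -> ed o r -> ntrue b i <= r &
      forall j, j < i -> ed (ntrue b j) (new_offset n b j)].
  elim: i => [|i IHi] im; first by split.
  have {IHi}[|sm lm low IH] := IHi; first lia.
  have e := ntrueDnfalse b i; have bi := bE i.
  have step : [/\ ntrue b i.+1 <= m, nfalse b i.+1 <= n.-1 - m,
      forall o r, m < o -> o <= n.-1 - nfalse b i.+1 -> r < n -> ed o r -> ntrue b i.+1 <= r &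
      ed (ntrue b i) (new_offset n b i)].
    rewrite /new_offset !ntrueS !nfalseS.
    case: (b i) bi => /= bi; rewrite ?addn0 ?addn1; last first.
      have /andP[mj ej] : (m < n.-1 - nfalse b i) && ed (ntrue b i) (n.-1 - nfalse b i).
        by rewrite -[_ && _]negbK -bi.
      split=> //; first lia.
      by move=> o r mo oj; apply: low; lia.
    have [mj|mj] := ltnP m (n.-1 - nfalse b i); last first.
      have lt : ntrue b i < m by lia.
      by split=> //; [move=> o r; lia|exact: sp].
    move: bi; rewrite mj /= => /esym bi.
    have [||q qm eq] := lf (n.-1 - nfalse b i); try lia.
    have sq : ntrue b i < q.
      have : ntrue b i <= q by apply: low eq; lia.
      rewrite leq_eqVlt => /predU1P[sq|//].
      by move: bi; rewrite sq edC eq.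
    have lt : ntrue b i < m by lia.
    split=> //; [|exact: sp].
    (* a later leaf o at the pivot would cross the edge from the next leaf to q *)
    move=> o r mo oj rn er; have := low o r mo oj rn er; rewrite leq_eqVlt => /predU1P[sr|//].
    have [oE|ne] := eqVneq o (n.-1 - nfalse b i).
      by have := lfu o r q; rewrite er oE eq => H; have := H mj; lia.
    case: (@nc r q o (n.-1 - nfalse b i)); rewrite ?[ed r o]edC ?[ed q _]edC //; lia.
  case: step => h1 h2 h3 h4; split=> // j; rewrite ltnS leq_eqVlt => /predU1P[->//|].
  exact: IH.
have [sm lm _ edges] := inv n.-1 (leqnn _).
have e := ntrueDnfalse b n.-1.
exists b; split=> // o o' oo' on eo.
have [om|om] := leqP o' m.
  have -> := sp' _ _ oo' om eo.
  have [|i [im io bi]] := @ntrue_onto b o n.-1; first lia.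
  by exists i; rewrite /new_offset bi io.
have [|i [im io bi]] := @nfalse_onto b (n.-1 - o') n.-1; first lia.
have lo : new_offset n b i = o' by rewrite /new_offset (negPf bi) io; lia.
exists i; split=> //; apply: (lfu o') => //; try lia.
- by have := new_offset_lt b im; lia.
- by rewrite edC -lo; apply: edges.
- by rewrite edC.
Qed.

Section Leaves.
Variables (T : finType) (E : {set {set T}}).
Hypotheses (simpleE : simple_graph E) (connE : connected_graph E).

Lemma edge_other e x : e \in E -> x \in e -> exists2 y, y != x & e = [set x; y]%SET.
Proof.
move=> /simpleE/eqP/cards2P[u [v [uv ->]]] /set2P[]->.
  by exists v; rewrite // eq_sym.
by exists u; rewrite // finset.setUC.
Qed.

Lemma degree1P x : degree E x = 1 ->
  exists2 y, y != x & [set x; y]%SET \in E /\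
    (forall e, e \in E -> x \in e -> e = [set x; y]%SET).
Proof.
move/eqP/cards1P=> [e eE].
have : e \in [set e]%SET by rewrite inE.
rewrite -eE inE => /andP[eIn xe].
have [y yx ey] := edge_other eIn xe; exists y => //; rewrite -ey; split=> // f fE xf.
have : f \in [set e in E | x \in e]%SET by rewrite inE fE.
by rewrite eE => /set1P.
Qed.

(** Two adjacent vertices of degree 1 would form a whole connected component. *)
Lemma leaf_neighbour x : 2 < #|T| -> degree E x = 1 ->
  exists2 y, degree E y != 1 & [set x; y]%SET \in E /\
    (forall e, e \in E -> x \in e -> e = [set x; y]%SET).
Proof.
move=> T3 /degree1P[y yx [xyE xu]]; exists y => //; apply/eqP=> /degree1P[z _ [_ yu]].
have xyz : [set x; y]%SET = [set y; z]%SET by apply: yu; rewrite ?set22.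
have cl : closed (adj E) (mem [set x; y]%SET).
  apply: intro_closed; first exact: connect_adjC.
  move=> u v; rewrite /adj => uvE /set2P[]uE; rewrite uE in uvE.
    by rewrite -(xu _ uvE (set21 _ _)) set22.
  by rewrite xyz -(yu _ uvE (set21 _ _)) set22.
suff : #|T| <= #|[set x; y]%SET| by rewrite cards2; case: (x != y); lia.
apply/subset_leq_card/fintype.subsetP => u _.
by rewrite -(closed_connect cl (connE x u)) set21.
Qed.

Lemma degree_gt0 x : 1 < #|T| -> 0 < degree E x.
Proof.
move=> T2; rewrite lt0n; apply/negP => /eqP/cards0_eq d0.
have cl : closed (adj E) (mem [set x]%SET).
  apply: intro_closed; first exact: connect_adjC.
  move=> u v; rewrite /adj => uvE /set1P uE; rewrite uE in uvE.
  have : [set x; v]%SET \in [set e in E | x \in e]%SET by rewrite inE uvE set21.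
  by rewrite d0 inE.
suff : #|T| <= #|[set x]%SET| by rewrite cards1; lia.
apply/subset_leq_card/fintype.subsetP => u _.
by rewrite -(closed_connect cl (connE x u)) set11.
Qed.

End Leaves.

(** This recovers the vertices of the spine from its edges, provided there is
an edge. *)
Lemma path_edges_cover (T : finType) (s : seq T) x : 1 < size s ->
  (x \in s) = [exists e in path_edges s, x \in e].
Proof.
case: s => [|y [|z s]] // _.
have consE u v r : path_edges (u :: v :: r) = ([set u; v] |: path_edges (v :: r))%SET.
  by rewrite /path_edges /= set_cons.
elim: s y z => [|u s IHs] y z.
  rewrite consE; apply/idP/existsP => [|[e]].
    move=> xs; exists [set y; z]%SET; rewrite setU11 /=.
    by move: xs; rewrite !inE.
  rewrite {1}/path_edges /= !inE => /andP[/orP[/eqP->|//]].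
  by rewrite !inE.
rewrite consE in_cons IHs; apply/orP/existsP => [[/eqP->|/existsP[e /andP[eE xe]]]|[e /andP[]]].
- by exists [set y; z]%SET; rewrite setU11 set21.
- by exists e; rewrite setU1r.
case/setU1P=> [->|eE xe].
  case/set2P=> ->; [by left|right]; apply/existsP; exists [set z; u]%SET.
  by rewrite consE setU11 set21.
by right; apply/existsP; exists e; rewrite eE.
Qed.

Section Spine.
Variables (R : realType) (n : nat) (E : {set {set 'I_n}}).
Hypotheses (n3 : 2 < n) (convE : convex_caterpillar R E).

(** The interval of labels is only known to carry the edges of the spine; when
the spine has no edge, the interval must be moved to its unique vertex. *)
Lemma convex_caterpillar_spine : exists a : 'I_n, exists2 m, m < n &
  spine_vertices E = [set:: traject (@ordS n) a m.+1]%SET /\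
  spine_edges E = path_edges (traject (@ordS n) a m.+1).
Proof.
case: convE => [[[simpleE connE _] [s [us sV sE]]] _ [a [m mn eE]]].
have T3 : 2 < #|'I_n| by rewrite card_ord.
case: s us sV sE => [|x [|y s]] us sV sE.
- have V0 z : degree E z = 1.
    have : z \notin spine_vertices E by rewrite sV inE.
    by rewrite inE negbK => /eqP.
  by have [y] := leaf_neighbour simpleE connE T3 (V0 a); rewrite V0.
- by exists x, 0; [lia|split].
exists a, m => //; split=> //; rewrite sV; apply/setP=> z; rewrite !finset.in_set.
case: m mn eE => [|m] mn eE.
  have : [set x; y]%SET \in spine_edges E by rewrite sE /path_edges /= set_cons setU11.
  by rewrite eE /path_edges inE.
by rewrite !path_edges_cover // -sE eE.
Qed.

Lemma convex_caterpillar_code : exists a : 'I_n, exists2 b, b 0 = false & E = code_graph a b.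
Proof.
have [a [m mn [sV sE]]] := convex_caterpillar_spine.
case: convE => [[[simpleE connE _] _] ncE _].
have T3 : 2 < #|'I_n| by rewrite card_ord.
pose ed o r := (o < n) && (r < n) && ([set offset a o; offset a r]%SET \in E).
have spV o : o < n -> (degree E (offset a o) != 1) = (o <= m).
  move=> on; have : (offset a o \in spine_vertices E) = (o <= m).
    by rewrite sV finset.in_set mem_traject_offset.
  by rewrite inE.
have edE o r : o < n -> r < n -> ed o r = ([set offset a o; offset a r]%SET \in E).
  by rewrite /ed => -> ->.
have edC : symmetric ed.
  by move=> o r; rewrite /ed finset.setUC [(o < n) && _]andbC.
have lf o : m < o -> o < n -> exists2 r, r <= m & ed o r /\
    (forall e, e \in E -> offset a o \in e -> e = [set offset a o; offset a r]%SET).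
  move=> mo on; have d1 : degree E (offset a o) = 1.
    by apply/eqP; rewrite -[_ == _]negbK spV //; lia.
  have [y] := leaf_neighbour simpleE connE T3 d1.
  have [r rn ->] := offset_onto a y; rewrite spV // => rm [oE ou].
  by exists r; rewrite ?edE.
have sp o : o < m -> ed o o.+1.
  move=> om; rewrite edE; try lia.
  have : [set offset a o; offset a o.+1]%SET \in spine_edges E.
    by rewrite sE; apply/path_edges_traject; exists o.
  by rewrite inE => /andP[].
have sp' o o' : o < o' -> o' <= m -> ed o o' -> o' = o.+1.
  move=> oo' om; rewrite edE; try lia; move=> oE.
  have : [set offset a o; offset a o']%SET \in spine_edges E.
    rewrite inE oE; apply/fintype.subsetP => x /set2P[]->; rewrite inE spV; lia.
  rewrite sE => /path_edges_traject[k km].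
  rewrite -/(offset a k) -/(offset a k.+1) => /eq_set2; rewrite offset_eq; try lia.
  by case=> [|[/offset_inj e1 /offset_inj e2]|[/offset_inj e1 /offset_inj e2]]; lia.
have lfu o r r' : m < o -> o < n -> r < n -> r' < n -> ed o r -> ed o r' -> r = r'.
  move=> mo on rn rn'; have [k km [ok ou]] := lf o mo on.
  have key q : q < n -> ed o q -> q = k.
    move=> qn; rewrite edE // => oqE; have E1 := ou _ oqE (set21 _ _).
    have ne : offset a o != offset a q by have := simpleE _ oqE; rewrite cards2; case: (_ != _).
    have oq : o != q by move: ne; rewrite offset_eq.
    have kn : k < n by lia.
    by case: (eq_set2 ne E1) => -[/offset_inj e1 /offset_inj e2]; lia.
  by move=> /(key _ rn)-> /(key _ rn')->.
have nc o1 o2 o3 o4 : o1 < o2 -> o2 < o3 -> o3 < o4 -> o4 < n ->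
    ed o1 o3 -> ed o2 o4 -> False.
  move=> h1 h2 h3 h4; rewrite !edE; try lia; move=> E1 E2.
  have ne : [set offset a o1; offset a o3]%SET != [set offset a o2; offset a o4]%SET.
    have ne13 : offset a o1 != offset a o3 by rewrite offset_eq; lia.
    by apply/eqP=> /(eq_set2 ne13)[] [/offset_inj e1 /offset_inj e2]; lia.
  have := ncE _ _ _ _ E1 E2 ne; apply/eqP/set0P.
  have c := @cross_offset R n a; apply: open_segment_cross.
  - by rewrite cross_swap oppr_gt0 c //; lia.
  - by rewrite c //; lia.
  - by rewrite -cross_rot c //; lia.
  - by rewrite cross_swap oppr_gt0 c //; lia.
(* the first spine vertex has degree at least 2 and at most one neighbour on the spine *)
have st : exists2 y, m < y < n & ed 0 y.
  have on : 0 < n by lia.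
  have : 1 < degree E (offset a 0).
    have := spV 0 on; rewrite leq0n; have := degree_gt0 connE (offset a 0) (ltnW T3); lia.
  case/card_gt1P=> e [f []]; rewrite !inE => /andP[eE oe] /andP[fE of_] ef.
  have [y yx ey] := edge_other simpleE eE oe; have [z zx fz] := edge_other simpleE fE of_.
  move: yx zx ey fz; have [k kn ->] := offset_onto a y; have [l ln ->] := offset_onto a z.
  rewrite !offset_eq // => k0 l0 ek fl.
  have e0k : ed 0 k by rewrite edE // -ek.
  have e0l : ed 0 l by rewrite edE // -fl.
  have [km|mk] := leqP k m; last by exists k => //; rewrite mk.
  have [lm|ml] := leqP l m; last by exists l => //; rewrite ml.
  have k1 : k = 1 by apply: sp' => //; lia.
  have l1 : l = 1 by apply: sp' => //; lia.
  by move: ef; rewrite ek fl k1 l1 eqxx.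
have lf' o : m < o -> o < n -> exists2 r, r <= m & ed o r.
  by move=> mo on; have [r rm [er _]] := lf o mo on; exists r.
have [b [b0 sub sup]] := greedy_code mn edC sp sp' lf' lfu nc st.
exists a, b => //; apply/setP=> e; apply/idP/code_graphP => [eE|[i im ->]]; last first.
  by have := sub i im; rewrite /ed => /andP[].
have /cards2P[x [y [xy exy]]] : #|e| == 2 by rewrite simpleE.
have [o on xo] := offset_onto a x; have [o' on' yo'] := offset_onto a y.
move: xy; rewrite xo yo' offset_eq // neq_ltn.
have e1 : ed o o' by rewrite edE // -xo -yo' -exy.
case/orP=> lt.
  have [i [im so lo]] := sup o o' lt on' e1; exists i => //.
  by rewrite exy xo yo' /code_edge /pivot /new_vertex so lo.
rewrite edC in e1; have [i [im so lo]] := sup o' o lt on e1; exists i => //.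
by rewrite exy xo yo' finset.setUC /code_edge /pivot /new_vertex so lo.
Qed.

End Spine.

(** * Codes with prescribed descents *)

Section Reconstruction.
Variable n : nat.
Hypothesis n3 : 2 < n.
Implicit Types (a : 'I_n) (b : nat -> bool).

(** When the last letter is read a single vertex remains, so both values of that
letter give the same edge. *)
Lemma code_graph_eq a b b' : (forall i, i < n.-2 -> b i = b' i) ->
  code_graph a b = code_graph a b'.
Proof.
move=> eqb; apply/setP=> e.
suff E i : i < n.-1 -> code_edge a b i = code_edge a b' i.
  by apply/code_graphP/code_graphP => -[i im ->]; exists i; rewrite ?E.
move=> im; have eqn j : j < i -> b j = b' j by move=> ji; apply: eqb; lia.
rewrite /code_edge /pivot /new_vertex (eq_ntrue eqn); congr [set _; offset a _]%SET.
have [e1 e2] := (ntrueDnfalse b' i, eq_nfalse eqn).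
rewrite /new_offset (eq_ntrue eqn) e2.
have [lt|ge] := ltnP i n.-2; first by rewrite eqb.
by case: (b i); case: (b' i); lia.
Qed.

(** If the arc is still straight before the last step, then a single label
remains, the first or the last one, and the descent in the last position tells
which. *)
Lemma straight_last a b : straight a b n.-2 ->
  a = (if b n.-2 (+) straight a b n.-1 then n.-1 - ntrue b n.-2 else nfalse b n.-2) :> nat.
Proof.
have -> : n.-1 = n.-2.+1 by lia.
rewrite /straight ntrueS nfalseS; have e := ntrueDnfalse b n.-2.
by case: (b _) => /=; case: ifP; lia.
Qed.

Lemma code_word_pivot a b a' b' i : i.+1 < n.-1 ->
  code_word a b = code_word a' b' -> pivot a b i.+1 = pivot a' b' i.+1.
Proof.
move=> im E; have im0 : i < n.-1 by lia.
have [pc pd cd] := pivot_neighbours a b im.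
apply/esym; apply: (@tperm_meet _ _ _ _ _ (previous a' b' i) (new_vertex a' b' i.+1) pc pd cd).
- by rewrite -!nth_code_word_previous // E.
- by rewrite -!nth_code_word // E.
Qed.

(** The graph determines the word, the word determines the pivots as common
letters of consecutive transpositions, and the pivots determine the code except
its last letter. *)
Lemma code_graph_straight a b a' b' i : b 0 = false -> b' 0 = false ->
  code_graph a b = code_graph a' b' -> i <= n.-2 -> straight a b i = straight a' b' i.
Proof.
move=> b0 b0' E im; have n1 : 1 < n by lia.
have wE : code_word a b = code_word a' b' by rewrite -!word_of_code // E.
have pE j : 0 < j -> j < n.-1 -> pivot a b j = pivot a' b' j.
  by case: j => // j _ jm; apply: code_word_pivot.
have aE : a = a'.
  by have := pE 1 isT; rewrite /pivot /= b0 b0' /offset /=; apply; lia.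
rewrite -aE in pE *; have [e e'] := (ntrueDnfalse b i, ntrueDnfalse b' i).
have : ntrue b i = ntrue b' i.
  case: i im e e' => // i im e e'.
  by apply: (@offset_inj n a); rewrite -?/(pivot _ _ _) ?pE //; lia.
by rewrite /straight; lia.
Qed.

Section FromDescents.
Variables (D : nat -> bool) (w : nat).

(** The word of the caterpillar with descent indicator D that wraps in step w:
descents give the complement of the next letter before w, and of the current
letter after w, while the letter at w is the descent just before it. *)
Definition steps_from i : bool :=
  if i is k.+1 then if i < w then ~~ D k else if i == w then D k else ~~ D i
  else false.

(** The starting label that makes the arc reach the first label, or the last
one, exactly in front of step w. *)
Definition start_from : nat :=
  if steps_from w then n.-1 - ntrue steps_from w else nfalse steps_from w.

Hypothesis wn : w <= n.-2.

Lemma start_lt : start_from < n.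
Proof. by rewrite /start_from; have := ntrueDnfalse steps_from w; case: ifP; lia. Qed.

Variable a : 'I_n.
Hypothesis aE : a = start_from :> nat.

Lemma start_straight i : straight a steps_from i = (i <= w).
Proof.
have sw : straight a steps_from w.
  by rewrite /straight aE /start_from; have := ntrueDnfalse steps_from w; case: ifP; lia.
have nsw : ~~ straight a steps_from w.+1.
  rewrite /straight aE /start_from ntrueS nfalseS; have := ntrueDnfalse steps_from w.
  by case: (steps_from w) => /=; lia.
have [iw|wi] := leqP i w; first exact: straightW iw sw.
by apply: contraNF nsw; apply: straightW.
Qed.

Lemma start_descent i : (w < n.-2 -> D w) -> i < n.-2 -> descent a steps_from i = D i.
Proof.
move=> Dw im; have im1 : i.+1 < n.-1 by lia.
have [lt|ge] := ltnP i w.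
  rewrite descent_straight ?start_straight //= /steps_from.
  move: lt; rewrite leq_eqVlt => /predU1P[<-|->]; last by rewrite addbT negbK.
  by rewrite ltnn eqxx addbF.
rewrite descent_wrapped ?start_straight //; last by lia.
move: ge; rewrite leq_eqVlt => /predU1P[wi|wi].
  by rewrite -wi leqnn Dw //; lia.
rewrite leqNgt wi /=; case: i im im1 wi => // i im im1 wi; rewrite /steps_from.
by rewrite !ifF ?negbK //; lia.
Qed.

End FromDescents.

(** The rules for descents can be solved for the letters of the code, step by
step, once the wrapping step is known. *)
Lemma code_from_descents a b w : b 0 = false -> w <= n.-2 -> straight a b w ->
    (w < n.-2 -> ~~ straight a b w.+1) ->
  [/\ w < n.-2 -> descent a b w,
      forall i, i < n.-2 -> b i = steps_from (descent a b) w i &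
      a = start_from (descent a b) w :> nat].
Proof.
move=> b0 wn sw nsw; set D := descent a b.
have Dlt i : i.+1 < n.-1 -> i.+1 < w -> D i = ~~ b i.+1.
  move=> im iw; rewrite /D descent_straight //; last exact: straightW (ltnW iw) sw.
  by rewrite (straightW iw sw) addbT.
have Dgt i : i.+1 < n.-1 -> w < i -> D i = ~~ b i.
  move=> im wi; have w2 : w < n.-2 by lia.
  have ns j : w < j -> ~~ straight a b j.
    by move=> wj; apply: contra (nsw w2); apply: straightW.
  by rewrite /D descent_wrapped ?(negPf (ns i wi)) // ns //; lia.
have Deq i : i.+1 < n.-2 -> i.+1 = w -> D i = b i.+1.
  move=> im iw; rewrite /D descent_straight ?iw //; last lia.
  by rewrite (negPf (nsw _)) ?addbF //; lia.
have bE i : i < n.-2 -> b i = steps_from D w i.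
  case: i => [|i] im; first by rewrite b0.
  rewrite /steps_from; case: ltngtP => [lt|gt|iw].
  - by rewrite Dlt ?negbK //; lia.
  - by rewrite Dgt ?negbK //; lia.
  - by rewrite Deq.
have eqb i : i < w -> b i = steps_from D w i by move=> iw; apply: bE; lia.
have e := ntrueDnfalse b w.
split=> //.
  by move=> w2; rewrite /D descent_wrapped ?sw ?nsw //; lia.
rewrite /start_from -(eq_ntrue eqb) -(eq_nfalse eqb).
have [w2|w2] := ltnP w n.-2.
  move: (nsw w2) sw; rewrite -bE // /straight ntrueS nfalseS.
  by case: (b w) => /=; lia.
have wE : w = n.-2 by lia.
rewrite wE in sw *; rewrite [LHS](straight_last sw).
suff -> : steps_from D n.-2 n.-2 = b n.-2 (+) straight a b n.-1 by [].
have nE : n.-2 = n.-2.-1.+1 by lia.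
rewrite [in LHS]nE /steps_from ltnn eqxx /D descent_straight -?nE //; last lia.
by congr (_ (+) straight _ _ _); lia.
Qed.

End Reconstruction.

(** The wrapping step parametrizes the caterpillars with descent set J; [None]
stands for the last step, which is never a position of a descent. *)
Lemma card_Des (R : realType) (n : nat) (n3 : 2 < n) (J : {set 'I_n.-2}) :
  #|[set c in convex_caterpillars R n | Des c == J]%SET| = #|J|.+1.
Proof.
pose D k := if insub k is Some j then j \in J else false.
have DE (j : 'I_n.-2) : D j = (j \in J) by rewrite /D valK.
pose wrap_time (o : option 'I_n.-2) : nat := if o is Some j then j else n.-2.
pose W : {set option 'I_n.-2} := (None |: (Some @: J))%SET.
have cardW : #|W| = #|J|.+1.
  rewrite cardsU1 card_imset; last by move=> ? ? [].
  by rewrite (_ : None \in _ = false) //; apply/imsetP => -[].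
pose a0 : 'I_n := Ordinal (ltn_trans (isT : 0 < 2) n3).
pose f o := code_graph (insubd a0 (start_from n D (wrap_time o))) (steps_from D (wrap_time o)).
have wrap_time_lt o : wrap_time o <= n.-2 by case: o => //= j; exact: ltnW.
have startE o : insubd a0 (start_from n D (wrap_time o)) = start_from n D (wrap_time o) :> nat.
  by rewrite val_insubd start_lt ?wrap_time_lt.
have wrap_timeW o : o \in W -> wrap_time o < n.-2 -> D (wrap_time o).
  case: o => [j|]; last by rewrite /= ltnn.
  by rewrite in_setU1 /= mem_imset ?DE // => ? ? [].
have n1 : 1 < n by lia.
have DesE a b : Des (code_graph a b) = J <-> forall j : 'I_n.-2, descent a b j = (j \in J).
  rewrite /Des word_of_code //; split=> [<- j|H]; first by rewrite Des_code.
  by apply/setP=> j; rewrite Des_code H.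
rewrite -cardW -(@card_in_imset _ _ f); last first.
  move=> o o' _ _ ff; suff : wrap_time o = wrap_time o'.
    case: o o' {ff} => [j|] [j'|] //= tE.
    - by congr Some; apply: val_inj.
    - by have := ltn_ord j; lia.
    - by have := ltn_ord j'; lia.
  have sE i : i <= n.-2 -> (i <= wrap_time o) = (i <= wrap_time o').
    move=> im; rewrite -!(start_straight n3 (wrap_time_lt _) (startE _)).
    exact: (code_graph_straight n3 _ _ ff im).
  have := (wrap_time_lt o, wrap_time_lt o') => -[l l'].
  by have := sE _ l; have := sE _ l'; rewrite !leqnn; lia.
congr #|pred_of_set _|; apply/setP=> E; rewrite inE inE.
apply/andP/imsetP => [[/asboolP convE /eqP DE']|[o oW ->]]; last first.
  split; first by apply/asboolP/code_graph_convex.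
  apply/eqP/DesE => j; rewrite -DE.
  by apply: (start_descent n3 (wrap_time_lt _) (startE _)) => //; exact: wrap_timeW.
have [a [b b0 EE]] := convex_caterpillar_code n3 convE.
rewrite EE in DE'; move/DesE: DE' => DJ.
have Deq i : i < n.-2 -> descent a b i = D i.
  by move=> im; have := DJ (Ordinal im); rewrite -DE.
have [w wn [sw nsw]] := exists_wrap a b.
have [Dw bE aE] := code_from_descents n3 b0 wn sw nsw.
have tE : exists2 o, o \in W & wrap_time o = w.
  have [w2|w2] := ltnP w n.-2; last by exists None; [rewrite setU11|rewrite /=; lia].
  exists (Some (Ordinal w2)) => //; rewrite in_setU1 /= mem_imset; last by move=> ? ? [].
  by rewrite -DJ Dw.
have [o oW ow] := tE; exists o => //.
have bitE i : (i < n.-2) || (i <= w) -> steps_from (descent a b) w i = steps_from D w i.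
  rewrite /steps_from; case: i => // i im; case: ltngtP => [lt|gt|eq]; rewrite Deq //; lia.
have bitE' i : i < n.-2 -> b i = steps_from D w i by move=> im; rewrite bE // bitE ?im.
rewrite EE /f ow (code_graph_eq n3 _ bitE'); congr code_graph.
apply: val_inj; rewrite /= -ow startE ow aE /start_from bitE ?leqnn ?orbT //.
have eqb i : i < w -> steps_from (descent a b) w i = steps_from D w i.
  by move=> iw; rewrite bitE // (ltnW iw) orbT.
by rewrite (eq_ntrue eqb) (eq_nfalse eqb).
Qed.

(** * The count *)

Lemma convex_caterpillar2 (R : realType) (E : {set {set 'I_2}}) :
  convex_caterpillar R E <-> E = [set [set: 'I_2]]%SET.
Proof.
have fullE (e : {set 'I_2}) : #|e| = 2 -> e = [set: 'I_2]%SET.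
  by move=> e2; apply/eqP; rewrite eqEcard finset.subsetT cardsT card_ord e2.
split=> [[[[simpleE connE _] _] _ _]|->].
  have sub e : e \in E -> e = [set: 'I_2]%SET by move=> /simpleE/fullE.
  apply/setP=> e; rewrite inE; apply/idP/eqP => [/sub //|->].
  have : 0 < degree E ord0 by apply: degree_gt0; rewrite ?card_ord.
  by case/card_gt0P=> f; rewrite inE => /andP[fE _]; rewrite -(sub f fE).
have spine0 : spine_vertices [set [set: 'I_2]]%SET = finset.set0.
  apply/setP=> x; rewrite !inE; apply/negbTE; rewrite negbK /degree.
  apply/cards1P; exists [set: 'I_2]%SET.
  by apply/setP=> e; rewrite !inE; apply: andb_idr => /eqP->; rewrite inE.
have edges0 : spine_edges [set [set: 'I_2]]%SET = finset.set0.
  apply/setP=> e; rewrite !inE spine0; apply/negbTE/andP=> -[/eqP->].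
  by move/fintype.subsetP/(_ ord0 (finset.in_setT _)); rewrite inE.
have adjE (x y : 'I_2) : x != y -> adj [set [set: 'I_2]]%SET x y.
  by move=> xy; rewrite /adj (fullE [set x; y]%SET) ?set11 // cards2 xy.
split; [split; [split|]| |].
- by move=> e /set1P->; rewrite cardsT card_ord.
- move=> x y; have [->|xy] := eqVneq x y; first exact: connect0.
  exact/connect1/adjE.
- move=> s s2 us; have : size s <= #|'I_2| by rewrite -(card_uniqP us) max_card.
  by rewrite card_ord leqNgt s2.
- by exists [::].
- by move=> x y z t /set1P-> /set1P->; rewrite eqxx.
- by exists ord0, 0.
Qed.

Theorem lemma1p11 (R : realType) (n : nat) (hn : (2 <= n)%N)
    (J : {set 'I_n.-2}) :
  #|[set c in convex_caterpillars R n | Des c == J]%SET| = #|J|.+1.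
Proof.
move: hn; rewrite leq_eqVlt => /predU1P[n2|n3]; last exact: card_Des.
subst n; have J0 (K : {set 'I_0}) : K = finset.set0 by apply/setP=> -[].
rewrite (J0 J) cards0; apply/eqP/cards1P; exists [set [set: 'I_2]]%SET.
apply/setP=> E; rewrite !inE (J0 (Des E)) eqxx andbT.
by apply/asboolP/eqP => /convex_caterpillar2.
Qed.
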